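(* Suppose that $\lim_{q\to\infty} q^{2}\Psi(q)=\lim_{q\to\infty}\omega(q)=0$ and $q\mapsto q^{2}\Psi(q)$ is non-increasing. Furthermore, suppose that $\omega(q)\geq \frac{45}{\Psi(q)}\Psi\left(\frac{1}{2q\Psi(q)}\right)$ for all $q$ sufficiently large. Then $E(\Psi,\omega)$ is uncountable.
   Context: Here $\Psi:(0,\infty)\to(0,\infty)$ is non-increasing and $\omega:(0,\infty)\to(0,1)$ satisfies $\lim_{q\to\infty}\omega(q)=0$. The set $E(\Psi,\omega)$ is the set of $x\in\mathbb R$ such that $|x-p/q|\leq \Psi(q)$ for infinitely many $(p,q)\in\mathbb Z\times\mathbb N$, and such that for all sufficiently large $q\in\mathbb N$ we have $|x-p/q|\geq (1-\omega(q))\Psi(q)$ for all $p\in\mathbb Z$. *)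

(* Defs.v *)
From mathcomp Require Import all_boot all_order all_algebra.
From mathcomp Require Import all_classical all_reals all_analysis.
Import Order.TTheory GRing.Theory Num.Theory.
Import numFieldNormedType.Exports.

Set Implicit Arguments.
Unset Strict Implicit.
Unset Printing Implicit Defensive.

Local Open Scope classical_set_scope.
Local Open Scope ring_scope.

(* Functions on (0, +oo) are represented by total functions R -> R; only their
   values at positive reals are ever used.  The denominators q are positive
   naturals, and the infinitude is that of the set of pairs (p, q), which need
   not be coprime. *)
Definition exact_approx (R : realType) (Psi omega : R -> R) : set R :=
  [set x : R |
    infinite_set [set pq : int * nat |
      (0 < pq.2)%N /\ `|x - pq.1%:~R / pq.2%:R| <= Psi pq.2%:R] /\
    (\forall q \near \oo, forall p : int,
      (1 - omega q%:R) * Psi q%:R <= `|x - p%:~R / q%:R|)].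

(* Main.v *)
(* To p/q attach the window [p/q + (1 - omega q) Psi q, p/q + Psi q], of length
   L = omega q Psi q. Farey fractions give c/d and a/b with |b c - a d| = 1, c/d
   in a prescribed half of the window and 1 / (b d) >= L / 18; the window of c/d
   then lies in that of p/q. Put Q = 1 / (q Psi q). A fraction s/r with
   q <= r <= Q / 2 is separated from the window of p/q, and one with
   Q / 2 < r < d from that of c/d, because Psi r <= L / 45. Hence nested windows
   shrink to points of the set, and the freedom of choosing the half lets such a
   point avoid any given sequence. *)
Require Import Defs.
From mathcomp Require Import all_boot all_order all_algebra.
From mathcomp Require Import all_classical all_reals all_analysis.
From mathcomp Require Import ring lra zify.
Import Order.TTheory GRing.Theory Num.Theory.
Import numFieldNormedType.Exports.
Local Open Scope classical_set_scope.
Local Open Scope ring_scope.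
Set Implicit Arguments.
Unset Strict Implicit.
Unset Printing Implicit Defensive.

(** * Farey neighbours, and a fraction in a short interval *)

(** Induction on the order, from the two integers around [x]: once the denominator [b + d] of the
    mediant is within the order, the mediant replaces the endpoint on its side of [x]. *)
Lemma farey_pair (R : realType) (x : R) (N : nat) : (0 < N)%N ->
  exists a b c d : int, [/\ 0 < b, 0 < d, b * c - a * d = 1,
    a%:~R / b%:~R <= x <= c%:~R / d%:~R &
    [/\ b <= N%:Z, d <= N%:Z & N%:Z < b + d]].
Proof.
elim: N => // -[_ _|N IH _].
  exists (Num.floor x), 1, (Num.floor x + 1), 1; split => //; first by lia.
  by rewrite !divr1 floor_le ltW // floorD1_gt.
have [a [b [c [d [b0 d0 det /andP[ax xc] [bN dN Nbd]]]]]] := IH isT.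
have [lt_bd|le_bd] := ltP N.+2%:Z (b + d).
  by exists a, b, c, d; split; rewrite ?ax //; split; lia.
have bR : (0 : R) < b%:~R by rewrite ltr0z.
have dR : (0 : R) < d%:~R by rewrite ltr0z.
have [xm|mx] := leP x ((a + c)%:~R / (b + d)%:~R).
  by exists a, b, (a + c), (b + d); split; rewrite ?ax //; last split; lia.
by exists (a + c), (b + d), c, d; split; rewrite ?(ltW mx) //; last split; lia.
Qed.

(** The numbers [1 / (d (k d + b))] decrease from [1 / (b d)] to 0, with no gap larger than the
    first, [1 / (b (b + d))]; the last one that is at least [lo] works. *)
Lemma unit_fraction_step (R : realType) (b d : int) (lo : R) :
  0 < b -> 0 < d -> 0 < lo -> lo * (b%:~R * d%:~R) <= 1 ->
  exists2 k : int, 0 <= k &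
    lo <= (d%:~R * (k * d + b)%:~R)^-1 <= lo + (b%:~R * (b + d)%:~R)^-1.
Proof.
move=> b0 d0 lo0 lo1.
have bR : (0 : R) < b%:~R by rewrite ltr0z.
have dR : (0 : R) < d%:~R by rewrite ltr0z.
(* The real [k] for which [1 / (d (k d + b))] equals [lo]. *)
pose y : R := ((lo * d%:~R)^-1 - b%:~R) / d%:~R.
have y0 : 0 <= y.
  apply: divr_ge0; last exact: ltW.
  rewrite subr_ge0 -[leRHS]mul1r ler_pdivlMr ?mulr_gt0 //.
  by rewrite mulrCA.
exists (Num.floor y); first by rewrite floor_ge0.
set k := Num.floor y.
have k0 : (0 : R) <= k%:~R by rewrite ler0z floor_ge0.
have ky : k%:~R <= y by exact: floor_le.
have yk : y < k%:~R + 1 by have := floorD1_gt y; rewrite intrD.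
have kdb0 : 0 < k%:~R * d%:~R + b%:~R :> R by rewrite ltr_wpDl // mulr_ge0 // ltW.
have ky' : lo * (d%:~R * (k%:~R * d%:~R + b%:~R)) <= 1.
  move: ky; rewrite ler_pdivlMr // lerBrDr -[leRHS]mul1r ler_pdivlMr ?mulr_gt0 //.
  by rewrite [leLHS]mulrC mulrA.
have yk' : 1 < lo * (d%:~R * ((k%:~R + 1) * d%:~R + b%:~R)).
  move: yk; rewrite ltr_pdivrMr // ltrBlDr -[ltLHS]mul1r ltr_pdivrMr ?mulr_gt0 //.
  by rewrite [ltRHS]mulrC mulrA.
rewrite !intrD !intrM; apply/andP; split.
  by rewrite -[leRHS]mul1r ler_pdivlMr ?mulr_gt0.
set h := (d%:~R * _)^-1.
set B := k%:~R * d%:~R + b%:~R in ky' yk' kdb0 h *.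
have BE : (k%:~R + 1) * d%:~R + b%:~R = B + d%:~R :> R by rewrite /B; ring.
rewrite BE in yk'.
have Bd0 : 0 < B + d%:~R by rewrite addr_gt0.
have loge : (d%:~R * (B + d%:~R))^-1 <= lo.
  by rewrite -[leLHS]mul1r ler_pdivrMr ?mulr_gt0 // ltW.
(* Term [k] is term [k + 1], at most [lo], plus one gap. *)
have -> : h = (d%:~R * (B + d%:~R))^-1 + (B * (B + d%:~R))^-1.
  by rewrite /h; field; rewrite !lt0r_neq0.
apply: lerD => //; rewrite lef_pV2 ?posrE; last first.
- by rewrite mulr_gt0 // addr_gt0.
- exact: mulr_gt0.
have bB : b%:~R <= B by rewrite /B lerDr mulr_ge0 // ltW.
by apply: ler_pM; rewrite ?addr_ge0 ?lerD2r // ltW.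
Qed.

(** The least [N] with [y <= N ^ 2] works: [4 <= y] forces [N >= 2], and for [N >= 3] minimality
    gives [N ^ 2 <= 9 / 4 (N - 1) ^ 2 < 3 y]. *)
Lemma exists_sqr_between (R : realType) (y : R) : 4 <= y ->
  exists2 N : nat, (0 < N)%N & y <= N%:R ^+ 2 <= 3 * y.
Proof.
move=> y4.
have exN : exists n : nat, y <= n%:R ^+ 2.
  have y0 : 0 <= y by lra.
  have := truncnS_gt y; set n := (Num.truncn y).+1 => ny.
  exists n; apply: (le_trans (ltW ny)).
  by rewrite -natrX ler_nat; nia.
case: (ex_minnP exN) => -[|[|[|n]]] yn nmin.
- by move: yn; rewrite expr0n /=; lra.
- by move: yn; rewrite expr1n; lra.
- by exists 2%N => //; rewrite yn /= -natrX; lra.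
- exists n.+3 => //; rewrite yn /=.
  have : n.+2%:R ^+ 2 < y by rewrite ltNge; apply/negP => /nmin; lia.
  have n0 : (0 : R) <= n%:R by exact: ler0n.
  rewrite -[n.+3]addn3 -[n.+2]addn2 !natrD; nra.
Qed.

(** As [e >= (e + f) / 2], one has [e (e + f) >= N ^ 2 / 2 >= 3 / (2 l)]. This bounds the first gap
    in [unit_fraction_step]. *)
Lemma farey_gap (R : realType) (e f : int) (N : nat) (l : R) :
  0 < l -> 3 <= l * N%:R ^+ 2 -> 0 < f -> f <= e -> N%:Z < e + f ->
  (e%:~R * (e + f)%:~R)^-1 <= 2 / 3 * l.
Proof.
move=> l0 lN f0 fe Nef.
have eR : (0 : R) < e%:~R by rewrite ltr0z (lt_le_trans f0 fe).
have efR : (0 : R) < (e + f)%:~R by rewrite ltr0z (le_lt_trans _ Nef).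
rewrite -[leLHS]mul1r ler_pdivrMr ?mulr_gt0 //.
have NS : N%:R <= (e + f)%:~R :> R by rewrite -[leLHS]/(N%:Z%:~R) ler_int ltW.
have Se : (e + f)%:~R <= 2 * e%:~R :> R.
  by rewrite -[2 in leRHS]/(2%:~R) -intrM ler_int mulr_natl mulr2n lerD2l.
have : N%:R ^+ 2 <= 2 * (e%:~R * (e + f)%:~R) :> R.
  by rewrite mulrA expr2; apply: ler_pM => //; exact: le_trans Se.
by rewrite -(ler_pM2l l0); lra.
Qed.

(** The absolute value leaves the order of [a / b] and [c / d] open: [fraction_in_interval] produces
    both. *)
Definition neighbors (a b c d : int) :=
  [/\ 0 < b, 0 < d & `|b * c - a * d| = 1].

(** Take Farey neighbours around [al] of an order [N] with [3 <= l N ^ 2 <= 9]. If [d <= b], the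
    fractions [(k c + a) / (k d + b)] approach [c / d] in gaps of at most [2 l / 3], so one of them
    falls in the interval unless [c / d] itself does; the other case is symmetric. *)
Lemma fraction_in_interval (R : realType) (al l : R) : 0 < l <= 1 / 2 ->
  exists a b c d : int, [/\ neighbors a b c d,
    al <= c%:~R / d%:~R, c%:~R / d%:~R + l / 18 <= al + l &
    l <= 9 / (b%:~R * d%:~R)].
Proof.
move=> /andP[l0 l2].
have [|N N0 /andP[yN Ny]] := @exists_sqr_between R (3 / l).
  by rewrite ler_pdivlMr //; lra.
have {}yN : 3 <= l * N%:R ^+ 2 by move: yN; rewrite ler_pdivrMr // mulrC.
have {}Ny : l * N%:R ^+ 2 <= 9.
  by move: Ny; rewrite mulrA ler_pdivlMr // mulrC; lra.
have [a [b [c [d [b0 d0 det /andP[ax xc] [bN dN Nbd]]]]]] := farey_pair al N0.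
have bR : (0 : R) < b%:~R by rewrite ltr0z.
have dR : (0 : R) < d%:~R by rewrite ltr0z.
have NR : (N%:R = N%:Z%:~R :> R) by [].
have bNR : b%:~R <= N%:R :> R by rewrite NR ler_int.
have dNR : d%:~R <= N%:R :> R by rewrite NR ler_int.
have detR : b%:~R * c%:~R - a%:~R * d%:~R = 1 :> R by rewrite -!intrM -intrB det.
have lbd : l * (b%:~R * d%:~R) <= 9.
  apply: le_trans Ny; rewrite ler_pM2l // expr2.
  by apply: ler_pM => //; exact: ltW.
have step (e f : int) := @farey_gap R e f N l l0 yN.
have cdE : c%:~R / d%:~R = a%:~R / b%:~R + (b%:~R * d%:~R)^-1 :> R.
  have -> : c%:~R = (1 + a%:~R * d%:~R) / b%:~R :> R.
    by apply: (canRL (mulfK (lt0r_neq0 bR))); clear -detR; lra.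
  by field; rewrite !lt0r_neq0.
have gap9 : l / 9 <= (b%:~R * d%:~R)^-1 :> R.
  by rewrite -[leRHS]mul1r ler_pdivlMr ?mulr_gt0 //; lra.
have [db|bd] := leP d b.
- have [cB|Bc] := leP (c%:~R / d%:~R) (al + l - l / 18).
    exists a, b, c, d; split => //; first by split => //; rewrite det.
    + lra.
    + by rewrite ler_pdivlMr ?mulr_gt0.
  (* A distance down from [c / d]: the first term bounds the product of the new denominators by
     [9 / l], the second keeps the fraction below [al + l - l / 18], and [lou] leaves [2 l / 3]
     above [al] for the overshoot. *)
  pose lo : R := Num.max (l / 9) (c%:~R / d%:~R - (al + l - l / 18)).
  have lo0 : 0 < lo by rewrite lt_max; apply/orP; left; lra.
  have lo9 : l / 9 <= lo by rewrite le_max lexx.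
  have lot : c%:~R / d%:~R - (al + l - l / 18) <= lo by rewrite le_max lexx orbT.
  have lou : lo <= c%:~R / d%:~R - al - 2 / 3 * l.
    rewrite ge_max; apply/andP; split; lra.
  have [|k k0 /andP[hlo hup]] := @unit_fraction_step R b d lo b0 d0 lo0.
    by rewrite -ler_pdivlMr ?mulr_gt0 // mul1r ge_max gap9 /=; lra.
  have st := step b d d0 db Nbd.
  exists c, d, (k * c + a), (k * d + b).
  have e0 : 0 < k * d + b by rewrite ltr_wpDl // mulr_ge0 // ltW.
  have eR : (0 : R) < (k * d + b)%:~R by rewrite ltr0z.
  have fE : (k * c + a)%:~R / (k * d + b)%:~R
     = c%:~R / d%:~R - (d%:~R * (k * d + b)%:~R)^-1 :> R.
    have -> : (k * c + a)%:~R = (c%:~R * (k * d + b)%:~R - 1) / d%:~R :> R.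
      by apply: (canRL (mulfK (lt0r_neq0 dR))); rewrite !(intrD, intrM); clear -detR; lra.
    by move: eR; move: ((k * d + b)%:~R : R) => e eR; field; rewrite !lt0r_neq0.
  split; rewrite ?fE.
  + by split => //; have -> : d * (k * c + a) - c * (k * d + b) = -1 by clear -det; lia.
  + lra.
  + lra.
  + by move: (le_trans lo9 hlo); rewrite ler_pdivrMr // mulrC.
(* Now distances go up from [a / b]; the fraction passes [al] by at most [l / 9 + 2 l / 3], less
   than [17 l / 18]. *)
- pose lo : R := Num.max (l / 9) (al - a%:~R / b%:~R).
  have lo0 : 0 < lo by rewrite lt_max; apply/orP; left; lra.
  have lo9 : l / 9 <= lo by rewrite le_max lexx.
  have lot : al - a%:~R / b%:~R <= lo by rewrite le_max lexx orbT.
  have lou : lo <= al - a%:~R / b%:~R + l / 9.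
    rewrite ge_max; apply/andP; split; lra.
  have [|k k0 /andP[hlo hup]] := @unit_fraction_step R d b lo d0 b0 lo0.
    by rewrite (mulrC d%:~R) -ler_pdivlMr ?mulr_gt0 // mul1r ge_max gap9 /=; lra.
  have Ndb : N%:Z < d + b by rewrite addrC.
  have st := step d b b0 (ltW bd) Ndb.
  exists a, b, (k * a + c), (k * b + d).
  have e0 : 0 < k * b + d by rewrite ltr_wpDl // mulr_ge0 // ltW.
  have eR : (0 : R) < (k * b + d)%:~R by rewrite ltr0z.
  have fE : (k * a + c)%:~R / (k * b + d)%:~R
     = a%:~R / b%:~R + (b%:~R * (k * b + d)%:~R)^-1 :> R.
    have -> : (k * a + c)%:~R = (a%:~R * (k * b + d)%:~R + 1) / b%:~R :> R.
      by apply: (canRL (mulfK (lt0r_neq0 bR))); rewrite !(intrD, intrM); clear -detR; lra.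
    by move: eR; move: ((k * b + d)%:~R : R) => e eR; field; rewrite !lt0r_neq0.
  split; rewrite ?fE.
  + by split => //; have -> : b * (k * a + c) - a * (k * b + d) = 1 by clear -det; lia.
  + lra.
  + lra.
  + by move: (le_trans lo9 hlo); rewrite ler_pdivrMr // mulrC.
Qed.

(** * Separation of distinct fractions *)

Lemma dist_fraction (R : realType) (c d s r : int) : 0 < d -> 0 < r ->
  `|c%:~R / d%:~R - s%:~R / r%:~R| = `|c * r - s * d|%:~R / (d%:~R * r%:~R) :> R.
Proof.
move=> d0 r0.
have dR : (0 : R) < d%:~R by rewrite ltr0z.
have rR : (0 : R) < r%:~R by rewrite ltr0z.
rewrite intr_norm intrB !intrM -[X in _ = _ / X]gtr0_norm ?mulr_gt0 // -normf_div.
by congr `|_|; field; rewrite !lt0r_neq0.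
Qed.

Lemma coprime_dist (R : realType) (c d s r : int) : 0 < d -> 0 < r ->
  c * r != s * d -> (d%:~R * r%:~R)^-1 <= `|c%:~R / d%:~R - s%:~R / r%:~R| :> R.
Proof.
move=> d0 r0 ne; rewrite dist_fraction // -[leLHS]mul1r ler_pM2r.
  by rewrite ler1z -gtz0_ge1 normr_gt0 subr_eq0.
by rewrite invr_gt0 mulr_gt0 // ltr0z.
Qed.

(* (s, r) = u (c, d) + v (a, b): either u = 0 and s/r = a/b, or |v| b >= d - r. *)
Lemma neighbors_dist (R : realType) (a b c d s r : int) :
  neighbors a b c d -> 0 < r -> 2 * r < d ->
  (b%:~R * d%:~R)^-1 <= `|c%:~R / d%:~R - s%:~R / r%:~R| :> R.
Proof.
case=> b0 d0 det r0 rd; rewrite dist_fraction //.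
have bR : (0 : R) < b%:~R by rewrite ltr0z.
have dR : (0 : R) < d%:~R by rewrite ltr0z.
have rR : (0 : R) < r%:~R by rewrite ltr0z.
have key : r <= b * `|c * r - s * d|.
  rewrite -{1}(gtr0_norm b0) -normrM.
  have -> : b * (c * r - s * d) = (b * c - a * d) * r + d * (a * r - s * b) by ring.
  move: det; move: (b * c - a * d) (a * r - s * b) => e w e1.
  have [->|w0] := eqVneq w 0; first by rewrite mulr0 addr0 normrM e1 mul1r gtr0_norm.
  have : d <= `|d * w| by rewrite normrM gtr0_norm // ler_peMr ?(ltW d0) // -gtz0_ge1 normr_gt0.
  have : `|e * r| = r by rewrite normrM e1 mul1r gtr0_norm.
  by clear -rd; lia.
rewrite ler_pdivlMr ?mulr_gt0 // ler_pdivrMl ?mulr_gt0 //.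
by rewrite mulrAC [leRHS]mulrC ler_pM2l // -intrM ler_int.
Qed.

Lemma neighbors_coprime (a b c d : int) : neighbors a b c d -> coprimez c d.
Proof.
case=> b0 d0 det; apply/coprimezP.
(* Multiplying by the determinant covers both of its signs. *)
exists ((b * c - a * d) * b, - ((b * c - a * d) * a)) => /=.
have -> : (b * c - a * d) * b * c + - ((b * c - a * d) * a) * d
  = (b * c - a * d) ^+ 2 by ring.
by apply/eqP; rewrite sqr_norm_eq1 det.
Qed.

Lemma eq_fraction_dvd (c d s r : int) :
  coprimez c d -> c * r = s * d -> (d %| r)%Z.
Proof.
rewrite coprimez_sym => cd e.
by rewrite -(Gauss_dvdzr _ cd) e dvdz_mull.
Qed.

(** * Windows, and the passage from one to the next *)

(** Both limits are reduced to bounds beyond one threshold, and the condition on [omega] is cleared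
    of its denominator. *)
Record small_beyond (R : realType) (Psi omega : R -> R) (q0 : R) : Prop := {
  threshold_ge1 : 1 <= q0;
  gauge_gt0 : forall q, 0 < q -> 0 < Psi q;
  rate_gt0 : forall q, 0 < q -> 0 < omega q < 1;
  gauge_le : forall q r, 0 < q -> q <= r -> Psi r <= Psi q;
  sqr_gauge_le : forall q r, 0 < q -> q <= r -> r ^+ 2 * Psi r <= q ^+ 2 * Psi q;
  sqr_gauge_small : forall q, q0 <= q -> q ^+ 2 * Psi q <= 1 / 8;
  rate_le_half : forall q, q0 <= q -> omega q <= 1 / 2;
  gauge_half_le : forall q, q0 <= q ->
    45 * Psi (1 / (2 * q * Psi q)) <= omega q * Psi q }.

(** The difference is signed: keeping only the right side of [p / q] makes the window a single
    interval. *)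
Definition window (R : realType) (Psi omega : R -> R) (p q : int) (x : R) :=
  (1 - omega q%:~R) * Psi q%:~R <= x - p%:~R / q%:~R <= Psi q%:~R.

Lemma ler_dist_transl (R : realDomainType) (x f y e : R) :
  `|x - f| <= e -> `|f - y| - e <= `|x - y|.
Proof.
move=> xf; rewrite lerBlDl; apply: le_trans (ler_distD x f y) _.
by rewrite lerD2r distrC.
Qed.

Lemma rate_gauge_le (R : realType) (Psi omega : R -> R) (q0 r : R) :
  small_beyond Psi omega q0 -> 0 < r -> (1 - omega r) * Psi r <= Psi r.
Proof.
move=> H r0; have /andP[w0 _] := rate_gt0 H r0.
by rewrite ler_piMl ?(ltW (gauge_gt0 H r0)) // gerBl ltW.
Qed.

Lemma window_dist (R : realType) (Psi omega : R -> R) (q0 : R) (p q : int) (x : R) :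
  small_beyond Psi omega q0 -> 0 < q -> window Psi omega p q x ->
  `|x - p%:~R / q%:~R| <= Psi q%:~R.
Proof.
move=> H q1 /andP[xl xu]; rewrite ger0_norm //; apply: le_trans xl.
have q1R : (0 : R) < q%:~R by rewrite ltr0z.
have /andP[_ w1] := rate_gt0 H q1R.
by rewrite mulr_ge0 ?subr_ge0 // ltW // (gauge_gt0 H).
Qed.

(** If [s / r] differs from [p / q], their distance is at least [1 / (q r) >= 2 Psi q], and [x] uses
    up at most [Psi q]. If they agree, [q] divides [r]: either [r = q], or [r >= 2 q] and
    [Psi r <= Psi q / 4]. *)
Lemma avoid_near (R : realType) (Psi omega : R -> R) (q0 : R) (p q s r : int) (x : R) :
  small_beyond Psi omega q0 -> q0 <= q%:~R -> coprimez p q ->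
  window Psi omega p q x -> q <= r -> r%:~R <= 1 / (2 * q%:~R * Psi q%:~R) ->
  (1 - omega r%:~R) * Psi r%:~R <= `|x - s%:~R / r%:~R|.
Proof.
move=> H q0q cop xw qr rQ.
have qR : (0 : R) < q%:~R by apply: lt_le_trans q0q; have := threshold_ge1 H; lra.
have qI : 0 < q by rewrite -(ltr0z R).
have rI : 0 < r by exact: lt_le_trans qr.
have qrR : (q%:~R : R) <= r%:~R by rewrite ler_int.
have rR : (0 : R) < r%:~R by rewrite ltr0z.
have Pq := gauge_gt0 H qR.
have [e|ne] := eqVneq (p * r) (s * q); last first.
  apply: le_trans (rate_gauge_le H rR) _.
  apply: le_trans (gauge_le H qR qrR) _.
  apply: le_trans (ler_dist_transl _ (window_dist H qI xw)).
  rewrite lerBrDr; apply: le_trans (coprime_dist R qI rI ne).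
  rewrite -[leRHS]mul1r ler_pdivlMr ?mulr_gt0 //.
  by move: rQ; rewrite ler_pdivlMr ?mulr_gt0 //; lra.
have -> : s%:~R / r%:~R = p%:~R / q%:~R :> R.
  by apply/eqP; rewrite eqr_div ?lt0r_neq0 // -!intrM e.
case/andP: xw => xl xu; apply: le_trans (le_trans xl (ler_norm _)).
have [->//|nrq] := eqVneq r q.
have q2r : 2 * q <= r.
  have /dvdzP[k rk] := eq_fraction_dvd cop e.
  have k2 : 2 <= k.
    have k0 : 0 < k by rewrite -(pmulr_lgt0 _ qI) -rk.
    by case: (k =P 1) nrq => [k1|]; [rewrite rk k1 mul1r eqxx | lia].
  by rewrite rk ler_pM2r.
apply: le_trans (rate_gauge_le H rR) _.
have q2rR : 2 * q%:~R <= r%:~R :> R by rewrite -[2 in leLHS]/(2%:~R) -intrM ler_int.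
have w2 := rate_le_half H q0q.
have s2 := sqr_gauge_le H qR qrR.
have Pr := gauge_gt0 H rR.
have : (2 * q%:~R) ^+ 2 * Psi r%:~R <= q%:~R ^+ 2 * Psi q%:~R.
  apply: le_trans s2; rewrite ler_pM2r //.
  by rewrite ler_sqr ?nnegrE ?mulr_ge0 // ltW.
rewrite exprMn -mulrA mulrCA ler_pM2l ?exprn_gt0 //.
have : 1 / 2 * Psi q%:~R <= (1 - omega q%:~R) * Psi q%:~R.
  by rewrite ler_pM2r //; lra.
lra.
Qed.

(** The distance from [c / d] to [s / r] is at least [2 Psi r], and [x] uses up at most
    [Psi d <= Psi r]. For [2 r < d] it is at least [1 / (b d) >= l / 9]; for [r < d <= 2 r] at least
    [1 / (d r) >= 4 Psi r], by the bound [1 / 8]. *)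
Lemma avoid_far (R : realType) (Psi omega : R -> R) (q0 l : R)
    (a b c d s r : int) (x : R) :
  small_beyond Psi omega q0 -> q0 <= r%:~R -> neighbors a b c d ->
  window Psi omega c d x -> r < d ->
  Psi r%:~R <= l / 22 -> l <= 9 / (b%:~R * d%:~R) ->
  (1 - omega r%:~R) * Psi r%:~R <= `|x - s%:~R / r%:~R|.
Proof.
move=> H q0r nb xw rd Prl lbd.
have rR : (0 : R) < r%:~R by apply: lt_le_trans q0r; have := threshold_ge1 H; lra.
have rI : 0 < r by rewrite -(ltr0z R).
have dI : 0 < d by exact: lt_trans rd.
have dR : (0 : R) < d%:~R by rewrite ltr0z.
have rdR : r%:~R <= d%:~R :> R by rewrite ler_int ltW.
apply: le_trans (rate_gauge_le H rR) _.
apply: le_trans (ler_dist_transl _ (window_dist H dI xw)).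
have Pdr := gauge_le H rR rdR.
have Pr := gauge_gt0 H rR.
have [r2d|dr2] := ltP (2 * r) d.
  by have := neighbors_dist R s nb rI r2d; lra.
have ne : c * r != s * d.
  apply/eqP => e; have /dvdzP[k rk] := eq_fraction_dvd (neighbors_coprime nb) e.
  have k0 : 0 < k by rewrite -(pmulr_lgt0 _ dI) -rk.
  by move: rd; rewrite rk gtr_pMl // ltNge -gtz0_ge1 k0.
have := coprime_dist R dI rI ne.
have : 4 * Psi r%:~R <= (d%:~R * r%:~R)^-1.
  rewrite -[leRHS]mul1r ler_pdivlMr ?mulr_gt0 //.
  have dr2R : d%:~R <= 2 * r%:~R :> R by rewrite -[2 in leRHS]/(2%:~R) -intrM ler_int.
  have := sqr_gauge_small H q0r.
  have : d%:~R * (r%:~R * Psi r%:~R) <= 2 * r%:~R * (r%:~R * Psi r%:~R).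
    by rewrite ler_pM2r // mulr_gt0.
  lra.
lra.
Qed.

Lemma next_fraction (R : realType) (Psi omega : R -> R) (q0 : R) (p q : int) (z : R) :
  small_beyond Psi omega q0 -> q0 <= q%:~R -> coprimez p q ->
  exists c d : int, [/\ q < d, coprimez c d, ~ window Psi omega c d z,
    forall x, window Psi omega c d x -> window Psi omega p q x &
    forall (s r : int) x, q <= r < d -> window Psi omega c d x ->
      (1 - omega r%:~R) * Psi r%:~R <= `|x - s%:~R / r%:~R|].
Proof.
move=> H q0q cop.
have q1 : (1 : R) <= q%:~R by apply: le_trans q0q; exact: threshold_ge1 H.
have qR : (0 : R) < q%:~R by lra.
have qI : 0 < q by rewrite -(ltr0z R).
have Pq := gauge_gt0 H qR.
have /andP[w0 w1] := rate_gt0 H qR.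
have w2 := rate_le_half H q0q.
have q2P := sqr_gauge_small H q0q.
pose left := p%:~R / q%:~R + (1 - omega q%:~R) * Psi q%:~R.
pose l := omega q%:~R * Psi q%:~R / 2.
have leftE : left + l + l = p%:~R / q%:~R + Psi q%:~R.
  by rewrite /left /l; field; rewrite lt0r_neq0.
have l0 : 0 < l by rewrite /l divr_gt0 // mulr_gt0.
have P8 : Psi q%:~R <= 1 / 8.
  apply: le_trans q2P; rewrite ler_peMl ?(ltW Pq) //.
  by rewrite expr2 mulr_ege1.
have l2 : l <= 1 / 2.
  have : omega q%:~R * Psi q%:~R <= Psi q%:~R by rewrite ler_piMl // ltW.
  by rewrite /l; lra.
(* The half away from [z]. The midpoint may count as left, since the new window starts strictly to
   the right of [c / d >= al]. *)
pose al := if z <= left + l then left + l else left.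
have al_ge : left <= al by rewrite /al; case: ifP; lra.
have al_le : al <= left + l by rewrite /al; case: ifP; lra.
have [|a [b [c [d [nb fl fu lbd]]]]] := @fraction_in_interval R al l.
  by rewrite l0.
have [b0 d0 _] := nb.
have dR : (0 : R) < d%:~R by rewrite ltr0z.
have left_gt : p%:~R / q%:~R < left by rewrite /left ltrDl mulr_gt0 // subr_gt0.
(* Distinct from [p / q] yet within [Psi q] of it, [c / d] satisfies [1 / (d q) <= Psi q]. *)
have Qd : 1 / (q%:~R * Psi q%:~R) <= d%:~R.
  have ne : c * q != p * d.
    apply/eqP => e; have : c%:~R / d%:~R = p%:~R / q%:~R :> R.
      by apply/eqP; rewrite eqr_div ?lt0r_neq0 // -!intrM e.
    by move: fl al_ge left_gt; lra.
  have := coprime_dist R d0 qI ne.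
  rewrite ger0_norm; last by lra.
  move=> /le_trans -/(_ (Psi q%:~R)) => D.
  have {D} : (d%:~R * q%:~R)^-1 <= Psi q%:~R by apply: D; lra.
  rewrite -[leLHS]mul1r !ler_pdivrMr ?mulr_gt0 //; lra.
have Q0 : 0 < 1 / (2 * q%:~R * Psi q%:~R) by rewrite divr_gt0 ?mulr_gt0.
have QE : 1 / (q%:~R * Psi q%:~R) = 2 * (1 / (2 * q%:~R * Psi q%:~R)).
  by field; rewrite !lt0r_neq0.
(* As [l] is half the window length, the constant 45 gives [2 l / 45], just below [l / 22]; this in
   turn is below the margin [l / 18] left to the right of [c / d]. *)
have PQ : Psi (1 / (2 * q%:~R * Psi q%:~R)) <= l / 22.
  have := gauge_half_le H q0q; have := gauge_gt0 H Q0; rewrite /l; lra.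
have Pd : Psi d%:~R <= l / 22 by apply: le_trans (gauge_le H Q0 _) PQ; lra.
have qd : q < d.
  rewrite -(ltr_int R); apply: lt_le_trans Qd.
  by rewrite ltr_pdivlMr ?mulr_gt0 //; lra.
have /andP[wd0 wd1] := rate_gt0 H dR.
have low0 : 0 < (1 - omega d%:~R) * Psi d%:~R.
  by rewrite mulr_gt0 ?subr_gt0 // (gauge_gt0 H).
have sub x : window Psi omega c d x -> window Psi omega p q x.
  case/andP=> xl xu; apply/andP; move: leftE; rewrite /left => leftE.
  by split; move: fl fu al_ge al_le leftE; rewrite /left; lra.
exists c, d; split => //.
- exact: neighbors_coprime nb.
- move=> /andP[zl zu]; move: fl fu; rewrite /al.
  by have [zm|mz] := leP z (left + l) => fl fu; lra.
- move=> s r x /andP[qr rd] xw.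
  have qrR : (q%:~R : R) <= r%:~R by rewrite ler_int.
  have [rQ|Qr] := leP r%:~R (1 / (2 * q%:~R * Psi q%:~R)).
    exact: (avoid_near s H q0q cop (sub x xw) qr rQ).
  apply: (@avoid_far _ _ _ _ _ _ _ _ _ s _ _ H _ nb xw rd _ lbd); first exact: le_trans qrR.
  by apply: le_trans PQ; apply: (gauge_le H Q0); exact: ltW.
Qed.

(** * Limit points of nested windows, and the diagonal argument *)

Lemma nested_bounds_point (R : realType) (L U : nat -> R) :
  (forall m n, L m <= U n) -> exists x, forall n, L n <= x <= U n.
Proof.
move=> LU; exists (sup (range L)) => n; apply/andP; split.
  by apply: ub_le_sup; [exists (U 0%N) => _ [m _ <-] | exists n].
by apply: ge_sup; [exists (L 0%N), 0%N | move=> _ [m _ <-]].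
Qed.

Lemma nested_windows_point (R : realType) (Psi omega : R -> R) (q0 : R)
    (p q : nat -> int) :
  small_beyond Psi omega q0 -> (forall n, 0 < q n) ->
  (forall n x, window Psi omega (p n.+1) (q n.+1) x -> window Psi omega (p n) (q n) x) ->
  exists x, forall n, window Psi omega (p n) (q n) x.
Proof.
move=> H q_gt0 nested.
pose L n := (p n)%:~R / (q n)%:~R + (1 - omega (q n)%:~R) * Psi (q n)%:~R.
pose U n := (p n)%:~R / (q n)%:~R + Psi (q n)%:~R.
have windowE n x : window Psi omega (p n) (q n) x = (L n <= x <= U n).
  by rewrite /window lerBrDl lerBlDl.
have LU n : L n <= U n.
  by rewrite lerD2l (rate_gauge_le H) // ltr0z.
have nested_le m n x : (m <= n)%N ->
    window Psi omega (p n) (q n) x -> window Psi omega (p m) (q m) x.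
  move=> /subnKC <-; elim: (n - m)%N => [|k IH]; first by rewrite addn0.
  by rewrite addnS => /nested.
have [|x xLU] := @nested_bounds_point R L U; last by exists x => n; rewrite windowE.
(* The left end of the deeper window lies in both windows. *)
move=> m n; have LM k : (k <= maxn m n)%N -> L k <= L (maxn m n) <= U k.
  by move=> km; rewrite -windowE; apply: nested_le km _; rewrite windowE lexx LU.
have /andP[Lm _] := LM m (leq_maxl _ _).
have /andP[_ Un] := LM n (leq_maxr _ _).
exact: le_trans Un.
Qed.

Lemma exact_approx_escapes (R : realType) (Psi omega : R -> R) (q0 : R) (z : nat -> R) :
  small_beyond Psi omega q0 -> exists2 x, exact_approx Psi omega x & forall n, x <> z n.
Proof.
move=> H.
pose good (s : int * int) := q0 <= s.2%:~R /\ coprimez s.1 s.2.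
(* The premise [good] gives every state a successor, as [choice] requires; on other states any value
   serves. *)
pose next (ns : nat * (int * int)) (t : int * int) := good ns.2 ->
  [/\ ns.2.2 < t.2, coprimez t.1 t.2, ~ window Psi omega t.1 t.2 (z ns.1),
    forall x, window Psi omega t.1 t.2 x -> window Psi omega ns.2.1 ns.2.2 x &
    forall (s r : int) x, ns.2.2 <= r < t.2 -> window Psi omega t.1 t.2 x ->
      (1 - omega r%:~R) * Psi r%:~R <= `|x - s%:~R / r%:~R|].
have [f fP] : {f & forall ns, next ns (f ns)}.
  apply: choice => -[n [p q]]; have [[gq gc]|ng] := pselect (good (p, q)).
    have [c [d P]] := next_fraction (z n) H gq gc.
    by exists (c, d).
  by exists (p, q).
(* Passing the index [n] to [f] makes stage [n] exclude [z n]; numerator 1 makes the start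
   coprime. *)
pose u := nat_rect (fun=> int * int)%type (1, Num.floor q0 + 1) (fun n s => f (n, s)).
have u_good n : good (u n).
  elim: n => [|n gn].
    by split; [exact: ltW (floorD1_gt _) | rewrite coprimezE /= coprime1n].
  have [qlt cop _ _ _] := fP (n, u n) gn; split => //.
  by case: gn => q0q _; apply: le_trans q0q _; rewrite ler_int ltW.
have uP n := fP (n, u n) (u_good n).
have q_ge1 n : 1 <= (u n).2.
  rewrite -(ler_int R); case: (u_good n) => q0q _.
  by apply: le_trans q0q; exact: threshold_ge1 H.
have [x xP] : exists x, forall n, window Psi omega (u n).1 (u n).2 x.
  apply: (nested_windows_point H) => n; first by rewrite gtz0_ge1.
  by case: (uP n).
have q_lt n : (u n).2 < (u n.+1).2 by case: (uP n).
have q_mono : {homo (fun n => (u n).2) : m n / (m < n)%N >-> m < n}.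
  by apply: homo_ltn q_lt; exact: lt_trans.
have q_ge n : n%:Z <= (u n).2.
  by elim: n => [|n IH]; [exact: le_trans (q_ge1 0%N) | have := q_lt n; lia].
exists x; last first.
  by move=> n xz; case: (uP n) => _ _ /= nz _ _; apply: nz; rewrite -xz; exact: (xP n.+1).
split.
  pose g n := ((u n).1, `|(u n).2|%N).
  move=> fin; apply: infinite_nat.
  have g_inj : injective g.
    move=> m n [_ e].
    have : (u m).2 = (u n).2 by have := q_ge1 m; have := q_ge1 n; lia.
    by case: (ltngtP m n) => // /q_mono /= + {}e; rewrite e ltxx.
  apply: sub_finite_set (finite_preimage (f := g) _ fin); last by move=> m n _ _; exact: g_inj.
  move=> n _ /=; have qn0 : 0 < (u n).2 by rewrite gtz0_ge1.
  split; first by rewrite absz_gt0 gt_eqF.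
  by rewrite natr_absz (gtr0_norm qn0); exact: window_dist H qn0 (xP n).
exists `|(u 0%N).2|%N => // r q0r s.
(* The least index whose denominator exceeds [r] is some [n.+1], so stage [n] handles [r]. *)
have exn : exists n, (r%:Z < (u n).2)%R by exists r.+1; have := q_ge r.+1; lia.
case: (ex_minnP exn) => -[|n] rn nmin.
  by have := q_ge1 0%N; move: rn q0r; rewrite /mkset; move: (u 0%N).2 => q; lia.
have nr : (u n).2 <= r%:Z by rewrite leNgt; apply/negP => /nmin; rewrite ltnn.
case: (uP n) => _ _ _ _ /(_ s r%:Z x); apply; last exact: (xP n.+1).
by rewrite nr.
Qed.

Theorem theorem1p1 (R : realType) (Psi omega : R -> R)
  (Psi_gt0 : forall q : R, 0 < q -> 0 < Psi q)
  (omega_01 : forall q : R, 0 < q -> 0 < omega q < 1)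
  (Psi_nonincr : {in `]0, +oo[%R &, {homo Psi : q r /~ q <= r}})
  (q2Psi_cvg0 : q ^+ 2 * Psi q @[q --> +oo] --> (0 : R))
  (omega_cvg0 : omega q @[q --> +oo] --> (0 : R))
  (q2Psi_nonincr :
    {in `]0, +oo[%R &, {homo (fun q : R => q ^+ 2 * Psi q) : q r /~ q <= r}})
  (omega_ge : \forall q \near +oo,
    45 / Psi q * Psi (1 / (2 * q * Psi q)) <= omega q) :
  ~ countable (exact_approx Psi omega).
Proof.
move=> /countable_injP[g g_inj].
have [Mq [_ hq]] : \forall q \near +oo, `|q ^+ 2 * Psi q| <= 1 / 8.
  by apply: (@cvgr0_norm_le R R R _ _ (fun q => q ^+ 2 * Psi q) q2Psi_cvg0); rewrite divr_gt0.
have [Mw [_ hw]] : \forall q \near +oo, `|omega q| <= 1 / 2.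
  by apply: (@cvgr0_norm_le R R R _ _ omega omega_cvg0); rewrite divr_gt0.
have [Mg [_ hg]] := omega_ge.
(* Neighbourhoods of [+oo] are given by strict bounds, hence the [+ 1]. *)
pose q0 : R := Num.max 1 (Num.max Mq (Num.max Mw Mg) + 1).
have q0P q : q0 <= q -> [/\ 1 <= q, Mq < q, Mw < q & Mg < q].
  rewrite ge_max => /andP[q1]; rewrite -lerBrDr ge_max => /andP[qM].
  by rewrite ge_max => /andP[qW qG]; split=> //; lra.
have H : small_beyond Psi omega q0.
  split => //.
  - by rewrite le_max lexx.
  - by move=> q r q_gt0 qr; apply: Psi_nonincr;
      rewrite ?in_itv /= ?andbT // (lt_le_trans q_gt0).
  - by move=> q r q_gt0 qr; apply: q2Psi_nonincr;
      rewrite ?in_itv /= ?andbT // (lt_le_trans q_gt0).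
  - by move=> q /q0P[_ /hq qs _ _]; exact: le_trans (ler_norm _) qs.
  - by move=> q /q0P[_ _ /hw qs _]; exact: le_trans (ler_norm _) qs.
  - move=> q /q0P[q1 _ _ /hg].
    have P0 : 0 < Psi q by apply: Psi_gt0; lra.
    by rewrite mulrAC ler_pdivrMr.
(* A left inverse of [g] on the set, with default 0 off its image; it lists every element, against
   [exact_approx_escapes]. *)
pose z n := xget 0 [set x | exact_approx Psi omega x /\ g x = n].
have [x Ex xz] := exact_approx_escapes z H.
apply: (xz (g x)); rewrite /z; case: xgetP => [y _ [Ey gy]|/(_ x)]; last by case.
by apply: g_inj; rewrite ?inE.
Qed.
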